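(* Let $B$ be a real matrix with $M$ rows in $\mathbb{R}^N$, where either (Gauss-Seidel case) $B=A^{1/2}$ for a symmetric positive definite $A\in\mathbb{R}^{N\times N}$ (so $M=N$ and $\Phi_1=B^TB=A$), or (Kaczmarz case) $B=A$ for some $A\in\mathbb{R}^{M\times N}$ with $M\ge N$ (so $\Phi_1=B^TB=A^TA$). For $n\ge1$ let $\Phi_n$ be the total quasi projector and $\mathrm{vol}_n$ the sum of squared volumes over all choices of $n$ rows of $B$. Then for every $n\ge1$, $$\Phi_n=\sum_{p=1}^{n}(-1)^{p-1}\,\mathrm{vol}_{n-p}\,\Phi_1^{\,p}.$$
   Context: $A^{1/2}$ is the symmetric positive definite square root of $A$. The index $i$, $1\le i\le\binom{M}{n}$, enumerates the $n$-element subsets of the row indices $\{1,\dots,M\}$ of $B$; $B_n(i)\in\mathbb{R}^{n\times N}$ is the submatrix of $B$ formed by the rows in the $i$-th subset, and $G_n(i)=B_n(i)B_n(i)^T$. The squared volume is $v_n^2(i)=\det G_n(i)$ (the square of the $n$-volume of the parallelepiped formed by the chosen rows). The quasi projector is $Q_n(i)=B_n(i)^T\,\mathrm{adj}(G_n(i))\,B_n(i)$, where $\mathrm{adj}$ denotes the adjugate matrix (the adjugate of a $1\times1$ matrix is $1$). The total quasi projector is $\Phi_n:=\sum_{i=1}^{\binom{M}{n}}Q_n(i)$, and $\mathrm{vol}_n:=\sum_{i=1}^{\binom{M}{n}}v_n^2(i)$ for $n\ge1$, with the convention $\mathrm{vol}_0=1$ (empty determinant). *)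

(* Defs.v *)
From HB Require Import structures.
From mathcomp Require Import all_boot all_order all_algebra.
From mathcomp Require Import reals.

Set Implicit Arguments.
Unset Strict Implicit.
Unset Printing Implicit Defensive.

Import Order.TTheory GRing.Theory Num.Theory.
Local Open Scope ring_scope.

Definition posdefmx (R : realType) (N : nat) (A : 'M[R]_N) : Prop :=
  A^T = A /\ forall x : 'cV[R]_N, x != 0 -> 0 < (x^T *m A *m x) 0 0.

(* [H] is A^(1/2). The positive definite square root is unique, so this relation
   determines [H]. *)
Definition posdef_sqrt (R : realType) (N : nat) (A H : 'M[R]_N) : Prop :=
  posdefmx H /\ H *m H = A.

Section QuasiProjectors.
Context {R : realType} {M N : nat}.
Implicit Types (B : 'M[R]_(M, N)) (S : {set 'I_M}).

(* [enum_val] lists [S] in increasing order, so this is B_n(i) with S the i-th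
   subset and n = #|S|. *)
Definition subrows B S : 'M[R]_(#|S|, N) :=
  rowsub (fun k : 'I_#|S| => enum_val k) B.

Definition gram B S : 'M[R]_#|S| := subrows B S *m (subrows B S)^T.

Definition sqvol B S : R := \det (gram B S).

Definition quasi_proj B S : 'M[R]_N :=
  (subrows B S)^T *m \adj (gram B S) *m subrows B S.

(* Sums over the n-element sets of row indices; for n > M they are empty. *)
Definition total_quasi_proj B (n : nat) : 'M[R]_N :=
  \sum_(S : {set 'I_M} | #|S| == n) quasi_proj B S.

Definition total_sqvol B (n : nat) : R :=
  \sum_(S : {set 'I_M} | #|S| == n) sqvol B S.

(* The convention vol_0 = 1 is the 0 x 0 determinant. *)
Lemma total_sqvol0 B : total_sqvol B 0 = 1.
Proof.
rewrite /total_sqvol (big_pred1 set0) => [|S]; last by rewrite cards_eq0.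
rewrite /sqvol; move: (gram B set0); rewrite cards0 => G.
exact: det_mx00.
Qed.

End QuasiProjectors.

(* Main.v *)
(* Write K = B B^T, so that G_n(i) = K_S for the i-th subset S. The expansion
   det(1 + tK) = sum_S t^|S| det(K_S) is the generating function of the vol_n. Applying
   it to K + (Bx)(yB^T) and using det(D + uv) = det D + v adj(D) u on both sides gives
   sum_S t^|S| Q_S = t B^T adj(1 + tK) B. Multiplying on the right by 1 + t B^T B and using
   B (1 + t B^T B) = (1 + tK) B, the right-hand side becomes t det(1 + tK) B^T B; the
   coefficient of t^(n+1) is the recurrence Phi_(n+1) + Phi_n Phi_1 = vol_n Phi_1. *)
Require Import Defs.
From HB Require Import structures.
From mathcomp Require Import all_boot all_order all_algebra.
From mathcomp Require Import reals.

Set Implicit Arguments.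
Unset Strict Implicit.
Unset Printing Implicit Defensive.

Import Order.TTheory GRing.Theory Num.Theory.
Local Open Scope ring_scope.

(* The determinant of [[1, -U], [V, 1]] can be computed by clearing either corner. *)
Lemma det_scalar1D_mulC (R : comPzRingType) (m n : nat)
    (U : 'M[R]_(m, n)) (V : 'M[R]_(n, m)) :
  \det (1%:M + U *m V) = \det (1%:M + V *m U).
Proof.
pose X := block_mx 1%:M (- U) V 1%:M.
have XL : X *m block_mx 1%:M 0 (- V) 1%:M = block_mx (1%:M + U *m V) (- U) 0 1%:M.
  rewrite mulmx_block !mulmx0 !mulmx1 !mul1mx mulmxN mulNmx opprK add0r.
  by rewrite subrr add0r.
have XR : X *m block_mx 1%:M U 0 1%:M = block_mx 1%:M 0 V (1%:M + V *m U).
  by rewrite mulmx_block !mulmx0 !mulmx1 !mul1mx !addr0 subrr addrC.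
have := congr1 determinant XL; rewrite det_mulmx det_lblock det_ublock !det1 !mulr1 => <-.
have := congr1 determinant XR; rewrite det_mulmx det_ublock det_lblock !det1 !mulr1 => ->.
by rewrite mul1r.
Qed.

(** Both sides come from the determinant of [[[A, -u], [v, 1]]]. Without an inverse of [A], clearing
    the upper right corner needs [\adj A *m u] and scales the last column by [\det A]. This leaves a
    common factor [\det A], which regularity cancels. *)
Lemma det_rank1D_reg (R : comPzRingType) (n : nat) (A : 'M[R]_n)
    (u : 'cV[R]_n) (v : 'rV[R]_n) :
  GRing.rreg (\det A) ->
  \det (A + u *m v) = \det A + (v *m \adj A *m u) 0 0.
Proof.
move=> regA; pose X := block_mx A (- u) v 1%:M.
have XL : X *m block_mx 1%:M 0 (- v) 1%:M = block_mx (A + u *m v) (- u) 0 1%:M.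
  rewrite mulmx_block !mulmx0 !mulmx1 !mul1mx mulmxN mulNmx opprK add0r.
  by rewrite subrr add0r.
have XR : X *m block_mx 1%:M (\adj A *m u) 0 (\det A)%:M =
    block_mx A 0 v (v *m \adj A *m u + (\det A)%:M).
  rewrite mulmx_block !mulmx0 !mulmx1 !mul1mx !addr0 !mulmxA mul_mx_adj.
  by rewrite scalar_mxC mulmxN subrr.
have := congr1 determinant XL.
rewrite det_mulmx det_lblock det_ublock !det1 !mulr1 => <-.
have := congr1 determinant XR.
rewrite det_mulmx det_ublock det_lblock !det1 mul1r det_scalar1 [\det A * _]mulrC.
by move/regA->; rewrite det_mx11 addrC !mxE eqxx mulr1n.
Qed.

Lemma det_rank1D (R : comNzRingType) (n : nat) (A : 'M[R]_n)
    (u : 'cV[R]_n) (v : 'rV[R]_n) :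
  \det (A + u *m v) = \det A + (v *m \adj A *m u) 0 0.
Proof.
(* [C = 'X%:M + A] specializes to [A] at 0 and has a monic, hence regular, determinant. *)
pose C := char_poly_mx (- A).
pose h : {rmorphism {poly R} -> R} := horner_eval (0 : R).
have hK m p (D : 'M[R]_(m, p)) : map_mx h (map_mx polyC D) = D.
  by apply/matrixP=> i j; rewrite !mxE /h /= /horner_eval hornerC.
have hC : map_mx h C = A.
  rewrite /C /char_poly_mx map_mxN opprK map_mxD hK map_scalar_mx.
  by rewrite /h /= /horner_eval hornerX raddf0 add0r.
have /(det_rank1D_reg (map_mx polyC u) (map_mx polyC v)) : GRing.rreg (\det C).
  exact/monic_rreg/char_poly_monic.
move/(congr1 h); rewrite rmorphD -!det_map_mx map_mxD map_mxM !hK hC => ->.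
congr (_ + _); transitivity (map_mx h (map_mx polyC v *m \adj C *m map_mx polyC u) 0 0).
  by rewrite [RHS]mxE.
by rewrite !map_mxM map_mx_adj !hK hC.
Qed.

(** Multilinearity in the rows: in each Leibniz product, [S] records the rows whose factor is taken
    from [A]. *)
Lemma det_addmx (R : comPzRingType) (n : nat) (A B : 'M[R]_n) :
  \det (A + B) =
  \sum_(S : {set 'I_n}) \det (\matrix_(i, j) if i \in S then A i j else B i j).
Proof.
rewrite exchange_big /=; apply: eq_bigr => s _; rewrite -big_distrr /=; congr (_ * _).
under eq_bigr do rewrite mxE; rewrite bigA_distr.
by apply: eq_bigr => S _; apply: eq_bigr => i _; rewrite mxE.
Qed.

Definition principal_submx (R : Type) (n : nat) (S : {set 'I_n}) (A : 'M[R]_n) :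
    'M[R]_#|S| :=
  mxsub enum_val enum_val A.

(* With [P] the 0-1 matrix selecting the rows in [S], the matrix on the left is
   [1 + P^T P (A - 1)], so [det_scalar1D_mulC] applies to it. *)
Lemma det_principal_submx (R : comPzRingType) (n : nat) (S : {set 'I_n})
    (A : 'M[R]_n) :
  \det (\matrix_(i, j) if i \in S then A i j else (1%:M : 'M[R]_n) i j) =
  \det (principal_submx S A).
Proof.
pose P : 'M[R]_(#|S|, n) := rowsub enum_val 1%:M.
have PA m (D : 'M[R]_(n, m)) : P *m D = rowsub enum_val D.
  by rewrite -rowsubE.
have PPT : P *m P^T = 1%:M.
  rewrite PA; apply/matrixP=> i j; rewrite !mxE eq_sym.
  by rewrite (inj_eq enum_val_inj).
transitivity (\det (1%:M + P^T *m (P *m (A - 1%:M)))); last first.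
  rewrite det_scalar1D_mulC -mulmxA mulmxBl mul1mx mulmxBr PPT addrC subrK.
  congr (\det _); rewrite mulmxA PA; apply/matrixP=> i j; rewrite !mxE.
  rewrite (bigD1 (enum_val j)) //= big1 ?addr0 ?mxE ?eqxx ?mulr1 // => k kj.
  by rewrite !mxE eq_sym (negPf kj) mulr0.
congr (\det _); apply/matrixP=> i j; rewrite PA !mxE.
have [iS|iS] := boolP (i \in S).
  rewrite (bigD1 (enum_rank_in iS i)) //= big1 ?addr0.
    by rewrite !mxE enum_rankK_in // eqxx mul1r addrC subrK.
  move=> k ki; rewrite !mxE; case: eqP => [ik|]; last by rewrite mul0r.
  by case/eqP: ki; apply: enum_val_inj; rewrite enum_rankK_in.
rewrite big1 ?addr0 // => k _; rewrite !mxE; case: eqP => [ik|]; last by rewrite mul0r.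
by rewrite -ik enum_valP in iS.
Qed.

Lemma det_scalar1D (R : comPzRingType) (n : nat) (A : 'M[R]_n) :
  \det (1%:M + A) = \sum_(S : {set 'I_n}) \det (principal_submx S A).
Proof.
rewrite addrC det_addmx; apply: eq_bigr => S _; exact: det_principal_submx.
Qed.

Lemma det_scalar1DZ (R : comNzRingType) (n : nat) (t : R) (A : 'M[R]_n) :
  \det (1%:M + t *: A) =
  \sum_(S : {set 'I_n}) t ^+ #|S| * \det (principal_submx S A).
Proof.
rewrite det_scalar1D; apply: eq_bigr => S _; rewrite -detZ.
by congr (\det _); apply/matrixP=> i j; rewrite !mxE.
Qed.

(* Replacing [B *m C] by [B *m (1%:M + x *m y) *m C], a perturbation of rank one, in
   [det_scalar1DZ] changes both sides by the entries of this identity when [x] and [y]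
   are unit vectors. *)
Lemma adj_scalar1DZ (R : comNzRingType) (m n : nat) (t : R)
    (B : 'M[R]_(m, n)) (C : 'M[R]_(n, m)) :
  t *: (C *m \adj (1%:M + t *: (B *m C)) *m B) =
  \sum_(S : {set 'I_m}) t ^+ #|S| *:
    (colsub enum_val C *m \adj (principal_submx S (B *m C)) *m rowsub enum_val B).
Proof.
set K := B *m C.
have entryE (D : 'M[R]_n) i j :
    D i j = ((delta_mx 0 i : 'rV_n) *m D *m (delta_mx j 0 : 'cV_n)) 0 0.
  by rewrite -rowE -colE !mxE.
apply/matrixP=> i j; rewrite summxE entryE.
under eq_bigr do rewrite entryE.
set y := delta_mx 0 i; set x := delta_mx j 0.
pose u := B *m x; pose v := y *m C.
have := det_scalar1DZ t (K + u *m v).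
rewrite scalerDr addrA scalemxAl det_rank1D det_scalar1DZ.
have subE S : principal_submx S (K + u *m v) =
    principal_submx S K + (rowsub enum_val B *m x) *m (y *m colsub enum_val C).
  by rewrite mul_rowsub_mx mulmx_colsub -mxsub_mul; apply/matrixP=> a b; rewrite !mxE.
under [X in _ = X]eq_bigr do rewrite subE det_rank1D mulrDr.
rewrite big_split /= => /addrI eqS.
transitivity ((v *m \adj (1%:M + t *: K) *m (t *: u)) 0 0).
  by rewrite -!scalemxAr -!scalemxAl !mulmxA.
rewrite eqS; apply: eq_bigr => S _.
by rewrite -!scalemxAr -!scalemxAl [RHS]mxE !mulmxA.
Qed.

Lemma gramE (R : realType) (M N : nat) (B : 'M[R]_(M, N)) S :
  gram B S = principal_submx S (B *m B^T).
Proof. by rewrite /gram /subrows trmx_mxsub -mxsub_mul. Qed.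

Lemma total_quasi_proj_rec (R : realType) (M N : nat) (B : 'M[R]_(M, N)) (n : nat) :
  total_quasi_proj B n.+1 =
  total_sqvol B n *: (B^T *m B) - total_quasi_proj B n *m (B^T *m B).
Proof.
(* Over [{poly R}] the variable ['X] serves as t, so that coefficients can be compared. *)
pose Bp := map_mx polyC B; pose A := B^T *m B.
have adjE := adj_scalar1DZ 'X Bp Bp^T.
have detE := det_scalar1DZ 'X (Bp *m Bp^T).
set E := 1%:M + _ in adjE detE.
have ApE : Bp^T *m Bp = map_mx polyC A by rewrite map_mxM map_trmx.
have KpE : Bp *m Bp^T = map_mx polyC (B *m B^T) by rewrite map_mxM map_trmx.
have WE : Bp^T *m \adj E *m Bp *m (1%:M + 'X *: (Bp^T *m Bp)) =
    \det E *: (Bp^T *m Bp).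
  have BE : Bp *m (1%:M + 'X *: (Bp^T *m Bp)) = E *m Bp.
    by rewrite mulmxDr mulmxDl mulmx1 mul1mx -scalemxAl -scalemxAr mulmxA.
  by rewrite -!mulmxA BE [\adj E *m _]mulmxA mul_adj_mx mul_scalar_mx -scalemxAr.
move/(congr1 (fun D => D *m (1%:M + 'X *: (Bp^T *m Bp)))): adjE.
rewrite -scalemxAl WE detE mulmxDr mulmx1 -scalemxAr ApE.
have QE (S : {set 'I_M}) : colsub enum_val Bp^T *m
    \adj (principal_submx S (Bp *m Bp^T)) *m rowsub enum_val Bp =
    map_mx polyC (quasi_proj B S).
  rewrite KpE /quasi_proj gramE !map_mxM map_mx_adj !map_mxsub map_trmx.
  by rewrite !trmx_mxsub map_mxM map_mxsub -!map_trmx.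
under [X in _ = X + _ -> _]eq_bigr do rewrite QE.
under [X in _ *: (X *m _)]eq_bigr do rewrite QE.
have vE (S : {set 'I_M}) :
    \det (principal_submx S (Bp *m Bp^T)) = (sqvol B S)%:P.
  by rewrite KpE /sqvol gramE -det_map_mx map_mxsub.
under [X in _ *: (X *: _) = _ -> _]eq_bigr do rewrite vE.
have coefE k m p (D : 'M[R]_(m, p)) l :
    map_mx (coefp l) ('X^k *: map_mx polyC D) = if k == l then D else 0.
  apply/matrixP=> i j; rewrite !mxE /= coefMC coefXn eq_sym.
  by case: eqP => _; rewrite ?mul1r ?mul0r ?mxE.
(* On the side of the quasi projectors, sets of size [n.+1] contribute through the summand 1 and
   sets of size [n] through ['X *: A]. On the side of the volumes, the outer factor ['X] leaves the
   sets of size [n]. *)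
move/(congr1 (map_mx (coefp n.+1))).
rewrite mulmx_suml scaler_sumr scaler_suml !scaler_sumr map_mxD !raddf_sum /=.
under eq_bigr => S _.
  rewrite scalerA mulrA -exprS -scalerA -map_mxZ coefE eqSS.
  over.
under [X in _ = X + _ -> _]eq_bigr do rewrite coefE.
under [X in _ = _ + X -> _]eq_bigr => S _.
  rewrite -scalemxAl scalerA -exprS -map_mxM coefE eqSS.
  over.
rewrite -!big_mkcond /= => eqn.
apply/eqP; rewrite eq_sym subr_eq; apply/eqP.
by rewrite /total_sqvol /total_quasi_proj scaler_suml mulmx_suml.
Qed.

Lemma total_quasi_proj0 (R : realType) (M N : nat) (B : 'M[R]_(M, N)) :
  total_quasi_proj B 0 = 0.
Proof.
rewrite /total_quasi_proj big1 // => S /eqP S0; rewrite /quasi_proj.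
(* The matrices are generalized so that their dimension [#|S|] can be rewritten to 0; [W] then has
   no rows. *)
move: (subrows B S) (gram B S); rewrite S0 => W V.
by rewrite [W]flatmx0 mulmx0.
Qed.

Lemma total_quasi_proj1 (R : realType) (M N : nat) (B : 'M[R]_(M, N)) :
  total_quasi_proj B 1 = B^T *m B.
Proof.
by rewrite total_quasi_proj_rec total_sqvol0 total_quasi_proj0 mul0mx subr0 scale1r.
Qed.

(** This is the recurrence unrolled; the induction can start at [n = 0], where both sides vanish. *)
Lemma total_quasi_proj_expansion (R : realType) (M N : nat) (B : 'M[R]_(M, N))
    (n : nat) :
  total_quasi_proj B n =
  \sum_(1 <= p < n.+1)
     ((-1) ^+ p.-1 * total_sqvol B (n - p)) *: total_quasi_proj B 1 ^+ p.
Proof.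
elim: n => [|n IHn]; first by rewrite big_nil total_quasi_proj0.
rewrite total_quasi_proj_rec -total_quasi_proj1 [in X in _ - X]IHn.
(* The term [p = 1] is the volume term of the recurrence. The remaining terms, shifted by one, are
   those of the induction hypothesis times minus [total_quasi_proj B 1]. *)
rewrite [RHS]big_ltn // expr0 mul1r expr1 subn1 [in RHS]big_add1 /=; congr (_ + _).
rewrite mulmx_suml -sumrN; apply: eq_big_nat => -[|p] //= _.
by rewrite subSS -scalemxAl -scaleNr -mulNr [(-1) ^+ p.+1]exprS mulN1r [_ ^+ p.+2]exprSr.
Qed.

Theorem corollary2 (R : realType) :
  (forall (N : nat) (A B : 'M[R]_N),
     posdefmx A -> posdef_sqrt A B ->
     [/\ total_quasi_proj B 1 = B^T *m B,
         B^T *m B = A &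
         forall n : nat, (1 <= n)%N ->
           total_quasi_proj B n =
           \sum_(1 <= p < n.+1)
              ((-1) ^+ p.-1 * total_sqvol B (n - p)) *: total_quasi_proj B 1 ^+ p])
  /\
  (forall (M N : nat) (A B : 'M[R]_(M, N)),
     (N <= M)%N -> B = A ->
     [/\ total_quasi_proj B 1 = B^T *m B,
         B^T *m B = A^T *m A &
         forall n : nat, (1 <= n)%N ->
           total_quasi_proj B n =
           \sum_(1 <= p < n.+1)
              ((-1) ^+ p.-1 * total_sqvol B (n - p)) *: total_quasi_proj B 1 ^+ p]).
Proof.
split=> [N A B _ [[Bsym _] BB]|M N A B _ ->]; split=> [||n _] //.
- exact: total_quasi_proj1.
(* Symmetry of the square root turns [B^T *m B] into [B *m B], which is [A]. *)
- by rewrite Bsym.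
- exact: total_quasi_proj_expansion.
- exact: total_quasi_proj1.
- exact: total_quasi_proj_expansion.
Qed.
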